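(* Let $G_1$ be a graph cellularly embedded in a closed surface, with edge set $E$, let $G_2$ be its surface dual and $G_3$ its phial, and suppose the map $G_3$ is rich. Then the maximum cardinality of a coboundary in $G_3$ equals $|E|$ minus the minimum cardinality of a strong $O$-join in $G_1$.
   Context: $2^E$ is the $GF(2)$-vector space of subsets of $E$ under symmetric difference; $A,B$ are orthogonal if $|A\cap B|$ is even, and $W^\perp$ is the set of subsets orthogonal to every element of $W$. A zigzag path (Petrie walk) of $G_1$ is a closed walk which at successive vertices alternately leaves along the edge immediately left and immediately right (in the local rotation) of the arriving edge; each edge is traversed exactly twice in total by the zigzag paths. $G_2$ is the graph with edge set $E$ whose vertices are the faces of $G_1$ (edge $e$ joins the faces on its two sides), and the phial $G_3$ is the graph with edge set $E$ whose vertices are the zigzag paths of $G_1$ (edge $e$ joins the zigzags traversing it). For $i=1,2,3$, $\mathcal{V}_i$ is the subspace of $2^E$ spanned by the vertex coboundaries of $G_i$ (the coboundary of a vertex is the set of non-loop edges incident to it). For a permutation $(i,j,k)$ of $(1,2,3)$, the cycle deficiency is $\mathrm{cdef}(G_i)=\dim(\mathcal{V}_i^\perp/(\mathcal{V}_j+\mathcal{V}_k))$, and $G_i$ is rich if $\mathrm{cdef}(G_i)=0$. A coboundary of a graph is a set of the form $\delta(W)$, the set of edges with exactly one end in the vertex subset $W$. A strong $O$-join of $G_1$ is a set $F\subseteq E$ such that for every vertex $v$ of $G_1$, the number of edges of $F$ in the coboundary of $v$ has the same parity as the degree of $v$, and for every face $f$ of $G_1$, the number of edges of $F$ in the boundary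 of $f$ has the same parity as the degree (length) of $f$. *)

(* Defs.v *)
From HB Require Import structures.
From mathcomp Require Import all_boot all_order all_algebra.

Set Implicit Arguments.
Unset Strict Implicit.
Unset Printing Implicit Defensive.

Import GRing.Theory.

(* Multigraphs on the edge set E: loops (one end) and parallel edges allowed. *)
Record mgraph (E : finType) := MGraph {
  vert : finType;
  ends : E -> {set vert};
  ends_card : forall e, 0 < #|ends e| <= 2
}.

Section Graph.
Variables (E : finType) (G : mgraph E).
Implicit Types (v : vert G) (W : {set vert G}) (e : E).

Definition is_loop e : bool := #|ends G e| == 1.

Definition vcoboundary v : {set E} :=
  [set e | (v \in ends G e) && ~~ is_loop e].

(* e has exactly one end in W: it has an end in W and an end outside W. *)
Definition coboundary W : {set E} :=
  [set e | [exists v in ends G e, v \in W] && [exists v in ends G e, v \notin W]].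

Definition degree v : nat :=
  \sum_(e | v \in ends G e) (if is_loop e then 2 else 1).

End Graph.

Section CycleSpace.
Variable E : finType.

(* 2^E as a vector space over GF(2); subsets enter through their indicators. *)
Definition edgeSpace : vectType 'F_2 := {ffun E -> ('F_2)^o}.

Definition chi (A : {set E}) : edgeSpace := [ffun e => ((e \in A)%:R : 'F_2)%R].

Definition cobSpace (G : mgraph E) : {vspace edgeSpace} :=
  <<[seq chi (vcoboundary v) | v : vert G]>>%VS.

Definition orthogonal_sets (A B : {set E}) : bool := ~~ odd #|A :&: B|.

(* The sets orthogonal to W form a subspace, so the span adds no element:
   see mem_perp. *)
Definition perp (W : {vspace edgeSpace}) : {vspace edgeSpace} :=
  <<[seq chi A | A in [pred A : {set E} |
      [forall B : {set E}, (chi B \in W) ==> orthogonal_sets A B]]]>>%VS.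

(* (U :\: V)%VS is a complement of U :&: V in U, so its dimension is that of
   U / (U :&: V).  For the three graphs of a map the last two coboundary
   spaces lie in the orthogonal of the first (cobSpace_perp below), and this is
   dim (perp (cobSpace Gi) / (cobSpace Gj + cobSpace Gk)). *)
Definition cdef (Gi Gj Gk : mgraph E) : nat :=
  \dim (perp (cobSpace Gi) :\: (cobSpace Gj + cobSpace Gk))%VS.

End CycleSpace.

Section Cells.
Variable T : finType.

Definition orb2 (s t : T -> T) (x : T) : {set T} :=
  [set y | connect [rel u w | (w == s u) || (w == t u)] x y].

Definition cell (s t : T -> T) : finType :=
  {c : {set T} | [exists x, c == orb2 s t x]}.

End Cells.

(* A graph cellularly embedded in a closed (connected, orientable or not)
   surface, given by its flags, i.e. the triangles of the barycentric
   subdivision of the surface.  The involution tau_i sends a flag to the flag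
   sharing its two corners of dimension other than i: tau0 changes the vertex
   only, tau1 the edge only, tau2 the face only.  Every such choice of
   involutions comes from an embedding.  The empty set of flags stands for the
   edgeless graph on the sphere. *)
Record surfMap := SurfMap {
  flag : finType;
  tau0 : flag -> flag;
  tau1 : flag -> flag;
  tau2 : flag -> flag;
  tau0K : involutive tau0;
  tau1K : involutive tau1;
  tau2K : involutive tau2;
  tau02C : forall x, tau0 (tau2 x) = tau2 (tau0 x);
  tau0_neq : forall x, tau0 x != x;
  tau1_neq : forall x, tau1 x != x;
  tau2_neq : forall x, tau2 x != x;
  tau02_neq : forall x, tau0 (tau2 x) != x;
  flag_connected : forall x y,
    connect [rel u w | [|| w == tau0 u, w == tau1 u | w == tau2 u]] x y
}.

Section Map.
Variable M : surfMap.
Local Notation t0 := (@tau0 M).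
Local Notation t1 := (@tau1 M).
Local Notation t2 := (@tau2 M).
Local Notation t02 := (fun x : flag M => tau0 (tau2 x)).

Definition edge : finType := cell t0 t2.

(* The 0-, 2- and "Petrie" cells, each the set of the flags it contains.
   A zigzag crosses from one side of each edge to the other while traversing it
   (tau0 o tau2), then turns at the corner it reaches (tau1); this is what
   makes its turns alternate between left and right. *)
Definition vertex : finType := cell t1 t2.
Definition face : finType := cell t0 t1.
Definition zigzag : finType := cell t02 t1.

Definition cell_ends (s t : flag M -> flag M) (e : edge) : {set cell s t} :=
  [set c : cell s t | ~~ [disjoint val c & val e]].

End Map.

Section Facts.

Lemma orb2_refl (T : finType) (s t : T -> T) x : x \in orb2 s t x.
Proof. by rewrite inE connect0. Qed.

Lemma orb2_csym (T : finType) (s t : T -> T) :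
  involutive s -> involutive t ->
  connect_sym [rel u w | (w == s u) || (w == t u)].
Proof.
move=> sK tK; apply: sym_connect_sym => x y /=.
by rewrite ![y == _]eq_sym (inv_eq sK) (inv_eq tK).
Qed.

Lemma orb2_eq (T : finType) (s t : T -> T) :
  involutive s -> involutive t ->
  forall x y, y \in orb2 s t x -> orb2 s t y = orb2 s t x.
Proof.
move=> sK tK x y; rewrite inE => xy; apply/setP=> z; rewrite !inE.
by rewrite (same_connect (orb2_csym sK tK) xy).
Qed.

Lemma cell_closed (T : finType) (s t : T -> T) (c : cell s t) x :
  x \in val c -> (s x \in val c) /\ (t x \in val c).
Proof.
case: c => c /= /existsP[y /eqP->]; rewrite !inE => yx; split;
  apply: connect_trans yx (connect1 _); by rewrite /= eqxx ?orbT.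
Qed.

Lemma cell_inj (T : finType) (s t : T -> T) :
  involutive s -> involutive t ->
  forall (c d : cell s t) x, x \in val c -> x \in val d -> c = d.
Proof.
move=> sK tK [c pc] [d pd] x /= xc xd; apply: val_inj => /=.
case/existsP: (pc) xc => y /eqP-> /(orb2_eq sK tK) <-.
by case/existsP: (pd) xd => z /eqP-> /(orb2_eq sK tK) <-.
Qed.

Lemma orb2_cell (T : finType) (s t : T -> T) (x : T) :
  [exists y, orb2 s t x == orb2 s t y].
Proof. by apply/existsP; exists x. Qed.

Definition cell_of (T : finType) (s t : T -> T) (x : T) : cell s t :=
  exist _ (orb2 s t x) (orb2_cell s t x).

Lemma mem_cell_of (T : finType) (s t : T -> T) x : x \in val (cell_of s t x).
Proof. exact: orb2_refl. Qed.

Variable M : surfMap.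
Local Notation t0 := (@tau0 M).
Local Notation t1 := (@tau1 M).
Local Notation t2 := (@tau2 M).
Local Notation t02 := (fun x : flag M => tau0 (tau2 x)).

Lemma tau02K : involutive t02.
Proof. by move=> x; rewrite /= -tau02C tau2K tau0K. Qed.

Lemma edgeP (e : edge M) :
  exists x, val e = [set x; t0 x; t2 x; t0 (t2 x)].
Proof.
case: e => e /= /existsP[x /eqP->]; exists x; apply/setP=> y.
apply/idP/idP; last first.
  have [h0 h2] := cell_closed (mem_cell_of t0 t2 x).
  have [h02 _] := cell_closed h2.
  by rewrite !inE -!orbA => /or4P[] /eqP->; rewrite ?connect0 //;
     [move: h0 | move: h2 | move: h02]; rewrite inE.
rewrite inE => /connectP[p]; elim/last_ind: p y => [|p z IH] y /=.
  by move=> _ ->; rewrite !inE eqxx.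
rewrite last_rcons rcons_path => /andP[/IH {}IH /= h] ->.
have := IH _ erefl; rewrite !inE -!orbA.
by case/or4P=> /eqP E; move: h; rewrite E -?tau02C ?tau0K ?tau2K -?tau02C ?tau2K ?tau0K;
   case/orP=> /eqP->; rewrite ?eqxx ?orbT.
Qed.

Lemma cell_ends_card (s t : flag M -> flag M) :
  involutive s -> involutive t ->
  [\/ s =1 t0, s =1 t2 | s =1 t02] \/ [\/ t =1 t0, t =1 t2 | t =1 t02] ->
  forall e : edge M, 0 < #|cell_ends s t e| <= 2.
Proof.
move=> sK tK st e; have [x ex] := edgeP e.
have xe : x \in val e by rewrite ex !inE eqxx.
have inends y (c : cell s t) : y \in val e -> y \in val c -> c \in cell_ends s t e.
  by move=> ye yc; rewrite inE; apply/pred0Pn; exists y; rewrite /= yc.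
apply/andP; split.
  by apply/card_gt0P; exists (cell_of s t x); apply: inends xe (mem_cell_of _ _ _).
have key: exists u : flag M -> flag M, (forall c : cell s t, forall y, y \in val c -> u y \in val c)
     /\ [\/ u =1 t0, u =1 t2 | u =1 t02].
  by case: st => h; [exists s | exists t]; split=> // c y /cell_closed[].
have [u [uc uE]] := key.
suff [y hy] : exists y, forall z, z \in val e ->
    forall c : cell s t, z \in val c -> c = cell_of s t x \/ c = cell_of s t y.
  apply: (@leq_trans #|[set cell_of s t x; cell_of s t y]|); last by rewrite cards2; case: (_ != _).
  apply/subset_leq_card/subsetP=> c; rewrite inE => /pred0Pn[z /= /andP[zc ze]].
  by rewrite !inE; case: (hy z ze c zc) => ->; rewrite eqxx ?orbT.
have cx z : z \in val (cell_of s t z) by apply: mem_cell_of.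
have inj := cell_inj sK tK.
exists (if u x == t0 x then t2 x else t0 x) => z ze c zc.
have hu : u z \in val c by apply: uc.
move: ze; rewrite ex !inE -!orbA.
have n20 : t2 x != t0 x.
  by apply/eqP=> E; have := tau02_neq x; rewrite E tau0K eqxx.
have n020 : t0 (t2 x) != t0 x.
  by rewrite (inj_eq (can_inj (@tau0K M))) tau2_neq.
case: uE => uE; rewrite !uE ?eqxx ?(negbTE n20) ?(negbTE n020).
all: case/or4P=> /eqP zE; subst z; rewrite uE ?tau0K ?tau2K in hu.
all: try by [left; apply: (inj _ _ _ zc) | right; apply: (inj _ _ _ zc)
           | left; apply: (inj _ _ _ hu) | right; apply: (inj _ _ _ hu)].
all: rewrite ?[t0 (t2 _)]tau02C ?tau0K ?tau2K in hu.
all: rewrite ?[t0 (t2 _)]tau02C ?tau0K ?tau2K in hu.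
all: by [left; apply: (inj _ _ _ zc) | right; apply: (inj _ _ _ zc)
           | left; apply: (inj _ _ _ hu) | right; apply: (inj _ _ _ hu)].
Qed.

End Facts.

Section MapGraphs.
Variable M : surfMap.

Lemma vertex_ends_card (e : edge M) :
  0 < #|cell_ends (@tau1 M) (@tau2 M) e| <= 2.
Proof.
apply: cell_ends_card; [exact: tau1K | exact: tau2K |].
by right; constructor 2.
Qed.

Lemma face_ends_card (e : edge M) :
  0 < #|cell_ends (@tau0 M) (@tau1 M) e| <= 2.
Proof.
apply: cell_ends_card; [exact: tau0K | exact: tau1K |].
by left; constructor 1.
Qed.

Lemma zigzag_ends_card (e : edge M) :
  0 < #|cell_ends (fun x : flag M => tau0 (tau2 x)) (@tau1 M) e| <= 2.
Proof.
apply: cell_ends_card; [exact: tau02K | exact: tau1K |].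
by left; constructor 3.
Qed.

Definition primal : mgraph (edge M) :=
  @MGraph (edge M) (vertex M) (@cell_ends M _ _) vertex_ends_card.
Definition dual : mgraph (edge M) :=
  @MGraph (edge M) (face M) (@cell_ends M _ _) face_ends_card.
Definition phial : mgraph (edge M) :=
  @MGraph (edge M) (zigzag M) (@cell_ends M _ _) zigzag_ends_card.

Definition phial_rich : Prop := cdef phial primal dual = 0.

(* The boundary of a face f is the coboundary of f in the dual: an edge having
   f on both sides is traversed twice by the facial walk and cancels.  The
   length of f is its degree in the dual. *)
Definition strong_Ojoin (F : {set edge M}) : bool :=
  [forall v : vert primal,
     odd #|F :&: vcoboundary v| == odd (degree v)] &&
  [forall f : vert dual,
     odd #|F :&: vcoboundary f| == odd (degree f)].

End MapGraphs.

Lemma odd_degree (E : finType) (G : mgraph E) (v : vert G) :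
  odd (degree v) = odd #|vcoboundary v|.
Proof.
rewrite /degree (bigID (@is_loop _ G)) /=.
rewrite (eq_bigr (fun=> 2)) => [|e /andP[_ ->] //].
rewrite [X in _ + X](eq_bigr (fun=> 1)) => [|e /andP[_ /negbTE->] //].
rewrite sum_nat_const oddD oddM andbF /= sum1_card; congr odd.
by apply: eq_card => e; rewrite !inE.
Qed.

(* The minimum size of a strong O-join is over a nonempty family. *)
Lemma strong_OjoinT (M : surfMap) : strong_Ojoin [set: edge M].
Proof.
by apply/andP; split; apply/forallP=> v; rewrite setTI odd_degree.
Qed.

Section PerpFacts.
Variable E : finType.
Local Open Scope ring_scope.

Let dot (x y : edgeSpace E) : 'F_2 := \sum_e (x e : 'F_2) * (y e : 'F_2).

Let dot_sym x y : dot x y = dot y x.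
Proof. by apply: eq_bigr => e _; rewrite mulrC. Qed.

Let dot_chi (A B : {set E}) : (dot (chi A) (chi B) == 0) = orthogonal_sets A B.
Proof.
have -> : dot (chi A) (chi B) = #|A :&: B|%:R.
  rewrite /dot -sum1_card natr_sum [RHS]big_mkcond /=; apply: eq_bigr => e _.
  by rewrite !ffunE inE; case: (e \in A); case: (e \in B);
     rewrite ?mul0r ?mulr0 ?mulr1.
by rewrite -(dvdn_pcharf (pchar_Fp (isT : prime 2))) dvdn2.
Qed.

Let dot_span (X : seq (edgeSpace E)) y :
  (forall x, x \in X -> dot x y = 0) ->
  forall x, x \in <<X>>%VS -> dot x y = 0.
Proof.
move=> h x; rewrite -[X]/(tval (in_tuple X)) => /coord_span ->.
rewrite /dot; under eq_bigr => e _ do rewrite sum_ffunE mulr_suml.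
rewrite exchange_big big1 // => i _.
have hi := h _ (mem_nth 0 (ltn_ord i)).
transitivity (coord (in_tuple X) i x * dot (in_tuple X)`_i y).
  by rewrite /dot mulr_sumr; apply: eq_bigr => e _; rewrite ffunE mulrA.
by rewrite hi mulr0.
Qed.

Let chi_supp (x : edgeSpace E) : chi [set e | (x e : 'F_2) != 0] = x.
Proof.
apply/ffunP=> e; rewrite ffunE inE.
by case: (x e) => -[|[|k]] hk //; apply: val_inj.
Qed.

Lemma mem_perp (W : {vspace edgeSpace E}) (A : {set E}) :
  (chi A \in perp W) =
  [forall B : {set E}, (chi B \in W) ==> orthogonal_sets A B].
Proof.
apply/idP/idP=> [hA | hA]; last by apply/memv_span/imageP; exists A.
apply/forallP=> B; apply/implyP=> hB; rewrite -dot_chi; apply/eqP.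
apply: dot_span hA => x /imageP[A' /forallP/(_ B)/implyP/(_ hB) hAB ->].
by apply/eqP; rewrite dot_chi.
Qed.

Lemma cobSpace_sub_perp (G H : mgraph E) :
  (forall v w, orthogonal_sets (@vcoboundary _ H w) (@vcoboundary _ G v)) ->
  (cobSpace H <= perp (cobSpace G))%VS.
Proof.
move=> h; apply/span_subvP=> x /imageP[w _ ->]; rewrite mem_perp.
apply/forallP=> B; apply/implyP=> hB; rewrite -dot_chi dot_sym; apply/eqP.
by apply: dot_span hB => y /imageP[v _ ->]; apply/eqP; rewrite dot_sym dot_chi.
Qed.

End PerpFacts.

Section Orthogonality.
Variable M : surfMap.
Local Notation t0 := (@tau0 M).
Local Notation t1 := (@tau1 M).
Local Notation t2 := (@tau2 M).

Let edge_mem (e : edge M) (x : flag M) : (x \in val e) = (e == cell_of t0 t2 x).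
Proof.
apply/idP/eqP=> [xe | ->]; last exact: mem_cell_of.
exact: cell_inj (@tau0K M) (@tau2K M) _ _ _ xe (mem_cell_of _ _ _).
Qed.

Let even_cap (A : {set flag M}) : (forall x, x \in A -> t1 x \in A) -> ~~ odd #|A|.
Proof.
have [n] := ubnP #|A|; elim: n A => // n IH A; rewrite ltnS => leA cA.
have [->|[x xA]] := set_0Vmem A; first by rewrite cards0.
have txA : t1 x \in A :\ x by rewrite !inE tau1_neq cA.
have E : #|A| = #|(A :\ x) :\ t1 x|.+2.
  by rewrite (cardsD1 x) xA (cardsD1 (t1 x)) txA.
rewrite E /= negbK; apply: IH; first by rewrite E in leA; apply: ltnW.
move=> y; rewrite !inE => /and3P[y1 y2 yA].
rewrite (inj_eq (can_inj (@tau1K M))) y2 cA // andbT.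
by rewrite (inv_eq (@tau1K M)) eq_sym eq_sym.
Qed.

Let vcobE (s t : flag M -> flag M) (sK : involutive s) (tK : involutive t)
  (h : forall e, 0 < #|@cell_ends M s t e| <= 2) (c : cell s t) e :
  (e \in @vcoboundary _ (MGraph h) c) =
  ~~ [disjoint val c & val e] && ~~ (val e \subset val c).
Proof.
rewrite inE /= inE; case: (boolP [disjoint _ & _]) => //= /pred0Pn[x /andP[/= xc xe]].
congr (~~ _); rewrite /is_loop /=.
have cE : c \in cell_ends s t e.
  by rewrite inE; apply/pred0Pn; exists x; rewrite /= xc.
apply/cards1P/subsetP=> [[d dE] y ye | sub].
  have : cell_of s t y \in cell_ends s t e.
    by rewrite inE; apply/pred0Pn; exists y; rewrite /= ye mem_cell_of.
  move: cE; rewrite dE !inE => /eqP-> /eqP<-; exact: mem_cell_of.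
exists c; apply/setP=> d; rewrite !inE; apply/idP/eqP => [|->].
  by case/pred0Pn=> y /= /andP[yd ye]; apply: cell_inj yd (sub _ ye).
by move: cE; rewrite inE.
Qed.

Let odd_edge (c d : {set flag M}) (u u' : flag M -> flag M) (e : edge M) :
  (forall x, (u x \in c) = (x \in c)) -> (forall x, (u' x \in d) = (x \in d)) ->
  [\/ u = t2 /\ u' = t0, u = t2 /\ u' = (fun x => t0 (t2 x)) |
     u = t0 /\ u' = (fun x => t0 (t2 x))] ->
  odd #|c :&: d :&: val e| =
  (~~ [disjoint c & val e] && ~~ (val e \subset c)) &&
  (~~ [disjoint d & val e] && ~~ (val e \subset d)).
Proof.
move=> cu du uE; have [x ex] := edgeP e.
have n20 : t2 x != t0 x.
  by apply/eqP=> E; have := tau02_neq x; rewrite E tau0K eqxx.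
have n020 : t0 (t2 x) != t0 x.
  by rewrite (inj_eq (can_inj (@tau0K M))) tau2_neq.
have cardE (A : {set flag M}) : #|A :&: val e| =
    (x \in A) + (t0 x \in A) + (t2 x \in A) + (t0 (t2 x) \in A).
  rewrite -sum1_card big_mkcond /=.
  rewrite (bigD1 x) // (bigD1 (t0 x)) ?tau0_neq //= (bigD1 (t2 x)) /=; last first.
    by rewrite tau2_neq n20.
  rewrite (bigD1 (t0 (t2 x))) /=; last by rewrite tau02_neq n020 tau0_neq.
  rewrite big1 ?addn0 => [|y].
    by rewrite !addnA ex !inE !eqxx ?orbT !andbT;
       move: (x \in A) (t0 x \in A) (t2 x \in A) (t0 (t2 x) \in A) => [] [] [] [].
  rewrite -!andbA => /and4P[n1 n2 n3 n4].
  by rewrite ex !inE (negbTE n1) (negbTE n2) (negbTE n3) (negbTE n4) andbF.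
have disjE (A : {set flag M}) : [disjoint A & val e] =
    ~~ [|| x \in A, t0 x \in A, t2 x \in A | t0 (t2 x) \in A].
  rewrite -setI_eq0 -cards_eq0 cardE.
  by move: (x \in A) (t0 x \in A) (t2 x \in A) (t0 (t2 x) \in A) => [] [] [] [].
have subE (A : {set flag M}) : (val e \subset A) =
    [&& x \in A, t0 x \in A, t2 x \in A & t0 (t2 x) \in A].
  by rewrite ex !subUset !sub1set -!andbA.
rewrite cardE !disjE !subE !inE.
have := cu x; have := cu (t0 x); have := cu (t2 x); have := cu (t0 (t2 x)).
have := du x; have := du (t0 x); have := du (t2 x); have := du (t0 (t2 x)).
have E1 : t2 (t0 x) = t0 (t2 x) by rewrite tau02C.
have E2 : t2 (t0 (t2 x)) = t0 x by rewrite tau02C !tau2K.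
have E3 : t0 (t2 (t0 x)) = t2 x by rewrite E1 tau0K.
have E4 : t0 (t2 (t2 x)) = t0 x by rewrite tau2K.
have E5 : t0 (t2 (t0 (t2 x))) = x by rewrite E2 tau0K.
case: uE => -[-> ->]; rewrite ?E5 ?E4 ?E3 ?E2 ?E1 ?tau0K ?tau2K.
all: move: (x \in c) (t0 x \in c) (t2 x \in c) (t0 (t2 x) \in c).
all: move: (x \in d) (t0 x \in d) (t2 x \in d) (t0 (t2 x) \in d).
all: by do 8!case.
Qed.

Let cell_stable (s t : flag M -> flag M) (sK : involutive s) (tK : involutive t)
  (c : cell s t) x :
  ((s x \in val c) = (x \in val c)) * ((t x \in val c) = (x \in val c)).
Proof.
split; apply/idP/idP=> [/cell_closed[h1 h2] | /cell_closed[] //].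
  by rewrite sK in h1.
by rewrite tK in h2.
Qed.

Let orthogonal_cells (c d : {set flag M}) (A B : {set edge M}) u u' :
  (forall x, x \in c -> t1 x \in c) -> (forall x, x \in d -> t1 x \in d) ->
  (forall x, (u x \in c) = (x \in c)) -> (forall x, (u' x \in d) = (x \in d)) ->
  [\/ u = t2 /\ u' = t0, u = t2 /\ u' = (fun x => t0 (t2 x)) |
     u = t0 /\ u' = (fun x => t0 (t2 x))] ->
  (forall e, (e \in A) = ~~ [disjoint c & val e] && ~~ (val e \subset c)) ->
  (forall e, (e \in B) = ~~ [disjoint d & val e] && ~~ (val e \subset d)) ->
  orthogonal_sets A B.
Proof.
move=> c1 d1 cu du uE AE BE.
have := @even_cap (c :&: d); rewrite /orthogonal_sets => h.
suff -> : odd #|A :&: B| = odd #|c :&: d|.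
  by apply: h => x; rewrite !inE => /andP[/c1-> /d1->].
rewrite -[in RHS]sum1_card (partition_big (cell_of t0 t2) predT) //=.
rewrite -sum1_card [in LHS]big_mkcond /= !(big_morph odd oddD (erefl : odd 0 = false)).
apply: eq_bigr => e _; rewrite inE AE BE -(odd_edge _ cu du uE).
rewrite sum1_card; have -> : #|c :&: d :&: val e| =
    #|[pred x in c :&: d | cell_of t0 t2 x == e]|.
  by apply: eq_card => x; rewrite !inE edge_mem [e == _]eq_sym.
have oddif n : odd (if odd n then 1 else 0) = odd n by case: (odd n).
exact: oddif.
Qed.

Let primal_dual v f :
  orthogonal_sets (@vcoboundary _ (primal M) v) (@vcoboundary _ (dual M) f).
Proof.
have K0 := @tau0K M; have K1 := @tau1K M; have K2 := @tau2K M.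
apply: (@orthogonal_cells (val v) (val f) _ _ t2 t0).
- by move=> x /cell_closed[].
- by move=> x /cell_closed[].
- by move=> x; apply: (cell_stable K1 K2 v x).2.
- by move=> x; apply: (cell_stable K0 K1 f x).1.
- by constructor 1.
- by move=> e; apply: vcobE.
- by move=> e; apply: vcobE.
Qed.

Let primal_phial v z :
  orthogonal_sets (@vcoboundary _ (primal M) v) (@vcoboundary _ (phial M) z).
Proof.
have K02 := @tau02K M; have K1 := @tau1K M; have K2 := @tau2K M.
apply: (@orthogonal_cells (val v) (val z) _ _ t2 (fun x => t0 (t2 x))).
- by move=> x /cell_closed[].
- by move=> x /cell_closed[].
- by move=> x; apply: (cell_stable K1 K2 v x).2.
- by move=> x; apply: (cell_stable K02 K1 z x).1.
- by constructor 2.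
- by move=> e; apply: vcobE.
- by move=> e; apply: vcobE.
Qed.

Let dual_phial f z :
  orthogonal_sets (@vcoboundary _ (dual M) f) (@vcoboundary _ (phial M) z).
Proof.
have K02 := @tau02K M; have K1 := @tau1K M; have K0 := @tau0K M.
apply: (@orthogonal_cells (val f) (val z) _ _ t0 (fun x => t0 (t2 x))).
- by move=> x /cell_closed[].
- by move=> x /cell_closed[].
- by move=> x; apply: (cell_stable K0 K1 f x).1.
- by move=> x; apply: (cell_stable K02 K1 z x).1.
- by constructor 3.
- by move=> e; apply: vcobE.
- by move=> e; apply: vcobE.
Qed.

Lemma cobSpace_perp :
  [/\ (cobSpace (dual M) + cobSpace (phial M) <= perp (cobSpace (primal M)))%VS,
      (cobSpace (primal M) + cobSpace (phial M) <= perp (cobSpace (dual M)))%VS &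
      (cobSpace (primal M) + cobSpace (dual M) <= perp (cobSpace (phial M)))%VS].
Proof.
have C (E : finType) (A B : {set E}) : orthogonal_sets A B -> orthogonal_sets B A.
  by rewrite /orthogonal_sets setIC.
split; rewrite subv_add; apply/andP; split; apply: cobSpace_sub_perp => v w.
- exact: C (primal_dual v w).
- exact: C (primal_phial v w).
- exact: primal_dual.
- exact: C (dual_phial v w).
- exact: primal_phial.
- exact: dual_phial.
Qed.

End Orthogonality.

(* Main.v *)
Require Import Defs.
From mathcomp Require Import all_boot all_algebra.

(** The complement of a strong O-join is exactly a set orthogonal to all vertex
    and face coboundaries, i.e. an element of the orthogonal of [V1 + V2].
    Richness of the phial says that [V1 + V2] contains the orthogonal of [V3], so
    by biduality such a set lies in [V3], whose elements are precisely the
    coboundaries of the phial.  Complementation therefore exchanges strong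
    O-joins of the map and coboundaries of its phial. *)

Set Implicit Arguments.
Unset Strict Implicit.
Unset Printing Implicit Defensive.

Import GRing.Theory.

Section EdgeSpace.
Variable E : finType.
Implicit Types (A B C D : {set E}) (x y : edgeSpace E).
Local Open Scope ring_scope.

Lemma F2_neq0E (k : 'F_2) : k = (k != 0)%:R.
Proof. by case: k => -[|[|k]] hk //; apply: val_inj. Qed.

Lemma F2_natr_eq0 n : (n%:R == 0 :> 'F_2) = ~~ odd n.
Proof. by rewrite -(dvdn_pcharf (pchar_Fp (isT : prime 2))) dvdn2. Qed.

Lemma chi_surj x : exists A, x = chi A.
Proof.
exists [set e | (x e : 'F_2) != 0].
by apply/ffunP=> e; rewrite ffunE inE -F2_neq0E.
Qed.

Lemma chi_inj : injective (@chi E).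
Proof.
move=> A B /ffunP eqAB; apply/setP=> e; have := eqAB e; rewrite !ffunE.
by case: (e \in A); case: (e \in B).
Qed.

Lemma chi_set0 : chi set0 = 0 :> edgeSpace E.
Proof. by apply/ffunP=> e; rewrite !ffunE inE. Qed.

Lemma chi_sum1 A : chi A = \sum_(e in A) chi [set e].
Proof.
apply/ffunP=> e; rewrite sum_ffunE ffunE.
under eq_bigr => a _ do rewrite ffunE inE eq_sym.
case: (boolP (e \in A)) => [eA | eNA].
  rewrite (bigD1 e) //= eqxx big1 ?addr0 // => a /andP[_ /negbTE->] //.
by rewrite big1 // => a aA; case: eqP => // ae; rewrite -ae aA in eNA.
Qed.

(** The only scalars are 0 and 1, so a linear combination amounts to the choice of the indices with
    a nonzero term. *)
Lemma mem_span_F2 (I : finType) (f : I -> edgeSpace E) x :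
  x \in <<[seq f i | i : I]>>%VS -> exists W : {set I}, x = \sum_(i in W) f i.
Proof.
rewrite span_def big_map big_enum /= => /memv_sumP[u uf ->].
exists [set i | u i != 0]; rewrite [RHS]big_mkcond; apply: eq_bigr => i _.
rewrite inE; case: eqP => //= /eqP; have /vlineP[k ->] := uf i isT.
by rewrite [k]F2_neq0E; case: (k != 0); rewrite ?scale1r // scale0r eqxx.
Qed.

Lemma orthogonal_setsC A B : orthogonal_sets A B = orthogonal_sets B A.
Proof. by rewrite /orthogonal_sets setIC. Qed.

(** The line through [chi D] contains only the indicators of [set0] and [D], and [set0] is
    orthogonal to everything. *)
Lemma mem_perp_line A D : (chi A \in perp <[chi D]>%VS) = orthogonal_sets A D.
Proof.
rewrite mem_perp; apply/forallP/idP=> [/(_ D) | AD B].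
  by rewrite memv_line.
apply/implyP=> /vlineP[k]; rewrite [k]F2_neq0E; case: (k != 0).
  by rewrite scale1r => /chi_inj->.
by rewrite scale0r -chi_set0 => /chi_inj->; rewrite /orthogonal_sets setI0 cards0.
Qed.

(* A set outside [W] is separated from [W] by a coordinate of [1 - projv W];
   this linear form is the pairing with the set where it is nonzero. *)
Lemma perp_perp_sub (W : {vspace edgeSpace E}) : (perp (perp W) <= W)%VS.
Proof.
apply/subvP=> x; have [A ->] := chi_surj x => Aperp; apply/negbNE/negP=> ANW.
pose g y := y - projv W y.
have [e0 ge0] : exists e, (g (chi A) e : 'F_2) != 0.
  apply/existsP; apply: contraNT ANW; rewrite negb_exists => /forallP g0.
  suff /subr0_eq-> : g (chi A) = 0 by apply: memv_proj.
  by apply/ffunP=> e; rewrite [RHS]ffunE; apply/eqP; have := g0 e; rewrite negbK.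
pose B := [set e | (g (chi [set e]) e0 : 'F_2) != 0].
have gE C : g (chi C) e0 = #|C :&: B|%:R :> 'F_2.
  rewrite /g [chi C in LHS]chi_sum1 linear_sum -sumrB sum_ffunE.
  rewrite -sum1_card natr_sum [RHS]big_mkcond [LHS]big_mkcond /=.
  apply: eq_bigr => e _; rewrite !inE; case: (e \in C) => //=.
  by rewrite [LHS]F2_neq0E /g; case: (_ != 0).
have BW : chi B \in perp W.
  rewrite mem_perp; apply/forallP=> C; apply/implyP=> CW.
  rewrite orthogonal_setsC /orthogonal_sets -F2_natr_eq0 -gE /g.
  by rewrite projv_id // subrr ffunE.
move: Aperp; rewrite mem_perp => /forallP/(_ B)/implyP/(_ BW).
by rewrite /orthogonal_sets -F2_natr_eq0 -gE (negbTE ge0).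
Qed.

(** A non-loop edge is counted once for each of its ends in [W], and this count is odd exactly when
    one end is in [W]; loops contribute to neither side. *)
Lemma chi_coboundary (G : mgraph E) (W : {set vert G}) :
  chi (coboundary W) = \sum_(v in W) chi (vcoboundary v).
Proof.
apply/ffunP=> e; rewrite sum_ffunE ffunE.
under eq_bigr => v _ do rewrite ffunE inE.
case: (boolP (is_loop G e)) => [/cards1P[a ea] | eNloop].
  rewrite big1 => [|v _]; last by rewrite andbF.
  case: (boolP (e \in _)) => //; rewrite inE ea.
  by case/andP=> /exists_inP[v /set1P->] aW /exists_inP[w /set1P->]; rewrite aW.
have /cards2P[a [b [ab eab]]] : #|ends G e| == 2%N.
  have := ends_card G e; move: eNloop; rewrite /is_loop.
  by case: #|_| => [|[|[|]]].
have -> : \sum_(v in W) ((v \in ends G e) && ~~ false)%:R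
          = (a \in W)%:R + (b \in W)%:R :> 'F_2.
  rewrite big_mkcond (bigD1 a) //= (bigD1 b) 1?eq_sym //= big1 => [|v].
    rewrite eab !inE !eqxx orbT addr0.
    by case: (a \in W); case: (b \in W).
  case/andP=> va vb; rewrite eab !inE (negbTE va) (negbTE vb).
  by case: (v \in W).
have -> : (e \in coboundary W) = (a \in W) (+) (b \in W).
  rewrite inE eab; apply/andP/idP.
    case=> /exists_inP[v] /set2P[]-> vW /exists_inP[w] /set2P[]-> wW;
      by move: vW wW; case: (a \in W); case: (b \in W).
  by case aW: (a \in W); case bW: (b \in W) => // _; split; apply/exists_inP;
    (exists a + exists b); rewrite ?set21 ?set22 ?aW ?bW.
by case: (a \in W); case: (b \in W); apply: val_inj.
Qed.

Lemma mem_cobSpace_vcoboundary (G : mgraph E) (v : vert G) :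
  chi (vcoboundary v) \in cobSpace G.
Proof. by apply/memv_span/imageP; exists v. Qed.

Lemma mem_cobSpaceP (G : mgraph E) A :
  reflect (exists W : {set vert G}, A = coboundary W) (chi A \in cobSpace G).
Proof.
apply: (iffP idP) => [/mem_span_F2[W eqA] | [W ->]].
  by exists W; apply: chi_inj; rewrite chi_coboundary.
rewrite chi_coboundary; apply: memv_suml => v _.
exact: mem_cobSpace_vcoboundary.
Qed.

(** The sets orthogonal to [D] form a subspace, so it suffices to test the generators. *)
Lemma cobSpace_sub_perp_line (G : mgraph E) D :
  (cobSpace G <= perp <[chi D]>)%VS =
  [forall v : vert G, orthogonal_sets D (vcoboundary v)].
Proof.
apply/idP/forallP=> [/subvP GD v | GD].
  by rewrite orthogonal_setsC -mem_perp_line GD ?mem_cobSpace_vcoboundary.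
by apply/span_subvP=> _ /imageP[v _ ->]; rewrite mem_perp_line orthogonal_setsC.
Qed.

End EdgeSpace.

(** [F] and its complement split the coboundary of [v], whose size has the parity of the degree
    because a loop counts twice there. *)
Lemma orthogonal_vcoboundaryC (E : finType) (G : mgraph E) (v : vert G)
    (F : {set E}) :
  orthogonal_sets (~: F) (vcoboundary v) =
  (odd #|F :&: vcoboundary v| == odd (degree v)).
Proof.
rewrite odd_degree /orthogonal_sets -(cardsID F (vcoboundary v)) oddD.
rewrite setDE ![vcoboundary v :&: _]setIC.
by case: (odd _); case: (odd _).
Qed.

Lemma strong_OjoinE (M : surfMap) (F : {set edge M}) :
  strong_Ojoin F =
  (cobSpace (primal M) + cobSpace (dual M) <= perp <[chi (~: F)]>)%VS.
Proof.
rewrite subv_add !cobSpace_sub_perp_line /strong_Ojoin.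
by congr (_ && _); apply: eq_forallb => v; rewrite orthogonal_vcoboundaryC.
Qed.

Lemma strong_Ojoin_phialP (M : surfMap) (F : {set edge M}) :
  phial_rich M ->
  reflect (exists W : {set vert (phial M)}, ~: F = coboundary W)
          (strong_Ojoin F).
Proof.
move=> /eqP; rewrite dimv_eq0 diffv_eq0 => rich.
rewrite strong_OjoinE.
apply: (iffP idP) => [sub | /mem_cobSpaceP FV].
  (* By biduality it is enough to test [~: F] against each [B] orthogonal to [V3]; richness puts
     such a [B] in [V1 + V2]. *)
  apply/mem_cobSpaceP/(subvP (perp_perp_sub _)); rewrite mem_perp.
  apply/forallP=> B; apply/implyP=> BV.
  by rewrite orthogonal_setsC -mem_perp_line (subvP sub) ?(subvP rich).
(* Conversely, [V1 + V2] is orthogonal to all of [V3], in particular to its member [~: F]. *)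
have [_ _ /subv_trans] := cobSpace_perp M; apply; apply/subvP=> x.
have [A ->] := chi_surj x; rewrite mem_perp_line mem_perp.
by move=> /forallP/(_ (~: F))/implyP/(_ FV).
Qed.

Theorem mainTheorem2 (M : surfMap) (hrich : phial_rich M) :
  \max_(W : {set vert (phial M)}) #|coboundary W| =
  #|edge M| - #|[arg min_(F < [set: edge M] | strong_Ojoin F) #|F|]|.
Proof.
case: arg_minnP => [|F Fjoin Fmin]; first exact: strong_OjoinT.
apply/eqP; rewrite eqn_leq; apply/andP; split.
  (* The complement of any coboundary is a strong O-join, hence at least as large as [F]. *)
  apply/bigmax_leqP=> W _; rewrite [#|coboundary W|]cardsCs leq_sub2l // Fmin //.
  by apply/(strong_Ojoin_phialP _ hrich); exists W; rewrite setCK.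
(* The complement of the minimum join [F] is a coboundary attaining the bound. *)
have /(strong_Ojoin_phialP _ hrich)[W eqFW] := Fjoin.
rewrite -[F]setCK -cardsCs eqFW; exact: (leq_bigmax W).
Qed.
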